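(* Let ${A}$ be a deterministic projective list update algorithm over a finite set $L$ of list items (with a fixed initial list state), described by its state function $S$. Then there exists a function $F:U\to\mathbb{N}$ with $F(x^i)\le i$ for all $x^i\in U$ such that the following holds. Let $Q\subseteq U$ be a set of unary projections containing unary projections to at least three different items, such that any two unary projections in $Q$ to different items form an agile pair of unary projections. Then one of the following two cases applies: (a) for all $x^i,y^j\in Q$ with $x\neq y$, setting $q=F(x^i)$ and $l=F(y^j)$, every request sequence $\sigma$ with $\sigma_x=x^i$ and $\sigma_y=y^j$ satisfies $S_{xy}(\sigma)=[xy]$ if $x_{(q)}$ is requested after $y_{(l)}$ in $\sigma$, and $S_{xy}(\sigma)=[yx]$ if $x_{(q)}$ is requested before $y_{(l)}$ in $\sigma$; (b) for all $x^i,y^j\in Q$ with $x\neq y$, setting $q=F(x^i)$ and $l=F(y^j)$, every request sequence $\sigma$ with $\sigma_x=x^i$ and $\sigma_y=y^j$ satisfies $S_{xy}(\sigma)=[xy]$ if $x_{(q)}$ is requested before $y_{(l)}$ in $\sigma$, and $S_{xy}(\sigma)=[yx]$ if $x_{(q)}$ is requested after $y_{(l)}$ in $\sigma$.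
   Context: List update problem: a list state is a linear order of the finite item set $L$, written $[x_1\ldots x_n]$ with $x_1$ at the front. A request sequence is a finite word over $L$. A deterministic algorithm with fixed initial list is identified with the function $S$ mapping each finite request sequence $\sigma$ to the list state $S(\sigma)$ after serving $\sigma$. For items $x,y$, $\sigma_{xy}$ (resp. $\sigma_x$) is the subsequence of $\sigma$ of requests to $x$ or $y$ (resp. to $x$), and $S_{xy}(\sigma)\in\{[xy],[yx]\}$ is the relative order of $x,y$ in $S(\sigma)$. The algorithm is projective if $S_{xy}(\sigma)=S_{xy}(\sigma_{xy})$ for all $x,y,\sigma$. A unary projection $x^i$ is the sequence of $i\ge0$ requests to item $x$; $U=\{x^i: x\in L, i\ge 0\}$, where $x^0$ and $y^0$ are regarded as different for different items $x\ne y$. If $\sigma_x=x^i$, $x_{(q)}$ is the $q$th request to $x$ in $\sigma$. $\mathrm{perm}(x^iy^j)$ is the set of request sequences with exactly $i$ requests to $x$ and $j$ to $y$. A pair $x^i,y^j$ ($x\neq y$) is agile if there are $\tau,\tau'\in\mathrm{perm}(x^iy^j)$ with $S_{xy}(\tau)=[xy]$ and $S_{xy}(\tau')=[yx]$. *)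

(* Defs.v *)
From mathcomp Require Import all_boot.

Set Implicit Arguments.
Unset Strict Implicit.
Unset Printing Implicit Defensive.

Section ListUpdate.

Variable L : finType.

(* A linear order of L, written as the sequence of all items, front item first. *)
Record list_state := ListState {
  state_seq :> seq L;
  state_seqP : perm_eq state_seq (enum L) }.

(* The subsequence of the entries equal to x or y: for a request sequence
   sigma this is sigma_xy, and for a list state it is the relative order of x
   and y, i.e. [:: x; y] or [:: y; x] when x and y are different. *)
Definition pair_proj (x y : L) (s : seq L) : seq L := filter (pred2 x y) s.

Definition item_proj (x : L) (s : seq L) : seq L := filter (pred1 x) s.

(* An algorithm with a fixed initial list is its state function S; the initial
   list is S [::]. *)
Definition projective (S : seq L -> list_state) : Prop :=
  forall (x y : L) (sigma : seq L),
    pair_proj x y (S sigma) = pair_proj x y (S (pair_proj x y sigma)).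

(* The pair (x, i) stands for x^i; in particular x^0 and y^0 are different
   for different x and y. *)
Definition unary : Type := (L * nat)%type.

Definition word (u : unary) : seq L := nseq u.2 u.1.

Definition agile (S : seq L -> list_state) (u v : unary) : Prop :=
  [/\ u.1 <> v.1,
      exists2 tau, perm_eq tau (word u ++ word v)
                 & pair_proj u.1 v.1 (S tau) = [:: u.1; v.1]
    & exists2 tau, perm_eq tau (word u ++ word v)
                 & pair_proj u.1 v.1 (S tau) = [:: v.1; u.1]].

(* The q-th request to x in sigma (q counted from 1) is at position p
   (p counted from 0).  No p satisfies this when q = 0. *)
Definition is_request (sigma : seq L) (x : L) (q p : nat) : Prop :=
  [/\ p < size sigma, nth x sigma p = x & count_mem x (take p.+1 sigma) = q].

(* Both requests exist and x_(q) comes before y_(l). *)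
Definition requested_before (sigma : seq L) (x : L) (q : nat) (y : L) (l : nat)
  : Prop :=
  exists p r, [/\ is_request sigma x q p, is_request sigma y l r & p < r].

End ListUpdate.

(* Main.v *)
(* If the requests to x^i and y^j have two adjacent occurrences x y whose swap
   changes the order of x and y, then inserting requests to a third item z
   anywhere else can never bring z between x and y in the list. Hence the order
   of z relative to x agrees with that relative to y, and it depends only on how
   many requests to z precede the swapped pair. If z^k is agile with x^i, the
   same argument applies to a swap of x and z at the same request to x, so the
   order of each pair is decided by which of the two critical requests comes
   first, with the same direction for all three pairs. The critical request of
   x^i does not depend on the partners, because agility is transitive on
   distinct items and so any two partners of x^i fit in a common triple. *)
Require Import Defs.
From mathcomp Require Import all_boot.
From mathcomp Require Import zify.
From Stdlib Require Import Classical IndefiniteDescription.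

Set Implicit Arguments.
Unset Strict Implicit.
Unset Printing Implicit Defensive.

(** * Merging, sorting and splitting of words *)

Section Words.

Variable T : eqType.
Implicit Types (x y z c : T) (s t w : seq T).

Lemma filter_pred1 x s : filter (pred1 x) s = nseq (count_mem x s) x.
Proof. by elim: s => //= c s ->; case: eqP => [->|]. Qed.

Lemma count_mem_cons x c s : count_mem x (c :: s) = (c == x) + count_mem x s.
Proof. by []. Qed.

Lemma count_mem_nseq x c n : count_mem x (nseq n c) = (c == x) * n.
Proof. exact: count_nseq. Qed.

Definition count_memE := (count_cat, count_mem_cons, count_mem_nseq, eqxx).

Lemma filter_pred2_predC1 x z s : x != z ->
  filter (pred2 x z) (filter (predC1 z) s) = nseq (count_mem x s) x.
Proof.
move=> xz; rewrite -filter_pred1 -filter_predI; apply: eq_filter => c /=.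
by case: (eqVneq c z) => [->|]; rewrite ?orbF ?andbT // eq_sym (negbTE xz) andbF.
Qed.

Lemma filter_pred2_pred2 x y z s : y != z -> x != z ->
  filter (pred2 x z) (filter (pred2 x y) s) = nseq (count_mem x s) x.
Proof.
move=> yz xz; rewrite -filter_pred1 -filter_predI; apply: eq_filter => c /=.
case: (eqVneq c x) => //= _; case: (eqVneq c z) => [->|] //=.
by rewrite eq_sym (negbTE yz).
Qed.

Lemma count_filter_predC1 z s : count_mem z (filter (predC1 z) s) = 0.
Proof. by elim: s => //= c s IH; case: eqVneq => //= /negbTE ->. Qed.

Lemma count_filter_pred2 x y s : count_mem x (filter (pred2 x y) s) = count_mem x s.
Proof. by rewrite count_filter; apply: eq_count => c /=; case: eqP. Qed.

Lemma filter_pred2C x y s : filter (pred2 x y) s = filter (pred2 y x) s.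
Proof. by apply: eq_filter => c /=; rewrite orbC. Qed.

Lemma filter_pred2_nseq x y n : filter (pred2 x y) (nseq n x) = nseq n x.
Proof. by rewrite filter_nseq /= eqxx mul1n. Qed.

Lemma nseq_split x p i : p < i -> nseq i x = nseq p x ++ x :: nseq (i - p).-1 x.
Proof. by move=> lt; rewrite -(nseqD p (i - p).-1.+1); congr nseq; lia. Qed.

Lemma count_filter_pred2r x z s : count_mem z (filter (pred2 x z) s) = count_mem z s.
Proof. by rewrite filter_pred2C count_filter_pred2. Qed.

Lemma filter_pred2_drop x y z s : x != z -> y != z ->
  filter (pred2 x y) (filter (predC1 z) s) = filter (pred2 x y) s.
Proof.
move=> xz yz; rewrite -filter_predI; apply: eq_filter => c /=.
by case: (eqVneq c z) => [->|]; rewrite ?andbT // ![z == _]eq_sym (negbTE xz) (negbTE yz).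
Qed.

Lemma filter_predC1_swap c z s t :
  filter (predC1 z) (s ++ c :: z :: t) = filter (predC1 z) (s ++ z :: c :: t).
Proof. by rewrite !filter_cat /= eqxx. Qed.

(** Requests to x serve as synchronisation points: between consecutive ones, the y's of [s] and the
    z's of [t] can be emitted independently. Induction on the total length. *)
Lemma interleave x y z s t : x != y -> x != z -> y != z ->
  count_mem x s = count_mem x t ->
  exists w, filter (pred2 x y) w = filter (pred2 x y) s /\
            filter (pred2 x z) w = filter (pred2 x z) t.
Proof.
move=> xy xz yz; move: {2}(size s + size t) (leqnn (size s + size t)) => n.
have [yx zx zy] : [/\ y == x = false, z == x = false & z == y = false].
  by split; apply/negbTE; rewrite eq_sym.
elim: n s t => [|n IH] s t.
  by case: s t => [|? ?] [|? ?] //= _ _; exists [::].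
have tail_t c t' : (size s + size (c :: t') <= n.+1) -> c != x ->
    count_mem x s = count_mem x (c :: t') ->
    exists w, filter (pred2 x y) w = filter (pred2 x y) s /\
            filter (pred2 x z) w = filter (pred2 x z) (c :: t').
  move=> /= le cx; rewrite (negbTE cx) add0n => eqc.
  have [|w [ws wt]] := IH s t' _ eqc; first by lia.
  case: (eqVneq c z) => [->|cz].
    by exists (z :: w); rewrite /= zx zy ws wt /= eqxx.
  by exists w.
case: t => [|c t].
  case: s tail_t => [|d s] _ /=; first by exists [::].
  rewrite addn0 => le; case: (eqVneq d x) => dx; first by lia.
  rewrite add0n => eqc; have [|w [ws wt]] := IH s [::] _ eqc.
    by rewrite /= addn0.
  case: (eqVneq d y) => dy; last by exists w.
  by exists (y :: w); rewrite /= yx (negbTE yz) wt ws eqxx dy.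
case: (eqVneq c x) => cx; last by move=> le eqc; apply: tail_t.
case: s tail_t => [|d s] _ /=; first by rewrite cx eqxx; lia.
move=> le; case: (eqVneq d x) => dx.
  rewrite cx eqxx => -[eqc]; have [|w [ws wt]] := IH s t _ eqc; first by lia.
  by exists (x :: w); rewrite /= eqxx /= ws wt dx.
rewrite add0n => eqc; have [|w [ws wt]] := IH s (c :: t) _ eqc.
  by rewrite /=; lia.
rewrite /= cx eqxx /= in wt *.
case: (eqVneq d y) => dy; last by exists w.
by exists (y :: w); rewrite /= yx (negbTE yz) wt ws eqxx dy.
Qed.

(** Bubble sort of the z's to the front. Restricting the swaps to words with the z-count and the
    z-free part of [w] lets applications reuse what is known of [w]. *)
Lemma bubble z (g : seq T -> bool) w :
  (forall w1 c w2, c != z ->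
     count_mem z (w1 ++ z :: c :: w2) = count_mem z w ->
     filter (predC1 z) (w1 ++ z :: c :: w2) = filter (predC1 z) w ->
     g (w1 ++ c :: z :: w2) = g (w1 ++ z :: c :: w2)) ->
  g w = g (nseq (count_mem z w) z ++ filter (predC1 z) w).
Proof.
move=> step.
have shift c n s t : c != z ->
    count_mem z (s ++ c :: nseq n z ++ t) = count_mem z w ->
    filter (predC1 z) (s ++ c :: nseq n z ++ t) = filter (predC1 z) w ->
    g (s ++ c :: nseq n z ++ t) = g (s ++ nseq n z ++ c :: t).
  move=> cz; elim: n s => [|n IH] s //= eqc eqf.
  rewrite step //; first last.
  - by rewrite -eqf !filter_cat /= eqxx (negbTE cz).
  - by rewrite -eqc !count_cat /= eqxx (negbTE cz).
  rewrite -cat_rcons IH ?cat_rcons //.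
    by rewrite -eqc !count_cat /= eqxx (negbTE cz).
  by rewrite -eqf !filter_cat /= eqxx (negbTE cz).
suff main s t : count_mem z (s ++ t) = count_mem z w ->
    filter (predC1 z) (s ++ t) = filter (predC1 z) w ->
    g (s ++ t) = g (s ++ nseq (count_mem z t) z ++ filter (predC1 z) t).
  exact: (main [::]).
elim: t s => [|c t IH] s eqc eqf //=.
rewrite -cat_rcons IH ?cat_rcons //.
case: (eqVneq c z) => [->//|cz] /=; rewrite shift //.
  rewrite -eqc !count_cat /= count_cat count_nseq /= eqxx mul1n.
  by rewrite count_filter_predC1 addn0.
rewrite -eqf !filter_cat /= filter_cat filter_nseq /= eqxx /= (negbTE cz) /=.
by rewrite filter_id.
Qed.

Lemma split_count x p s : p < count_mem x s ->
  exists s1 s2, s = s1 ++ x :: s2 /\ count_mem x s1 = p.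
Proof.
elim: s p => //= c s IH p; case: (eqVneq c x) => [->|cx].
  case: p => [|p]; first by exists [::], s.
  rewrite add1n ltnS => /IH [s1 [s2 [-> <-]]].
  by exists (x :: s1), s2; rewrite /= eqxx.
move=> /IH [s1 [s2 [-> <-]]].
by exists (c :: s1), s2; rewrite /= (negbTE cx).
Qed.

(** The indices count earlier requests, so they start from 0, whereas [is_request] counts from 1. *)
Definition precedes s x p y r := exists s1 s2 s3,
  [/\ s = s1 ++ x :: s2 ++ y :: s3, count_mem x s1 = p
    & count_mem y (s1 ++ x :: s2) = r].

Lemma precedes_total s x p y r : x != y ->
  p < count_mem x s -> r < count_mem y s ->
  precedes s x p y r \/ precedes s y r x p.
Proof.
move=> xy ltp ltr; have yx : y == x = false by rewrite eq_sym (negbTE xy).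
have [s1 [s2 [es cs]]] := split_count ltp.
case: (ltnP r (count_mem y s1)) => [/split_count [t1 [t2 [et ct]]]|le].
  right; exists t1, t2, s2; split=> //.
  - by rewrite es et -catA.
  - by rewrite -et.
have lt2 : r - count_mem y s1 < count_mem y s2.
  by move: ltr; rewrite es count_cat /= (negbTE xy); lia.
have [t1 [t2 [et ct]]] := split_count lt2.
left; exists s1, t1, t2; split; rewrite ?es ?et //.
by rewrite count_cat /= (negbTE xy) ct; lia.
Qed.

Lemma filter_pred2_uniq x y s :
  uniq s -> x \in s -> y \in s -> x != y ->
  filter (pred2 x y) s =
    if index x s < index y s then [:: x; y] else [:: y; x].
Proof.
have one u v t : u \notin t -> uniq t -> v \in t ->
    filter (pred2 u v) t = [:: v].
  move=> ut Ut vt; rewrite -(filter_pred1_uniq Ut vt).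
  by apply: eq_in_filter => c ct /=; case: (eqVneq c u) ct ut => // -> ->.
elim: s => //= c s IH /andP[cs Us]; rewrite !inE => xs ys xy.
have yx : y == x = false by rewrite eq_sym (negbTE xy).
case: (eqVneq c x) => [ecx|cx]; first subst c.
  move: ys; rewrite (negbTE xy) yx /= => ys.
  by rewrite one.
case: (eqVneq c y) => [ecy|cy] /=; first subst c.
  by move: xs; rewrite (negbTE xy) /= => xs; rewrite filter_pred2C one.
move: xs ys; rewrite ![_ == c]eq_sym (negbTE cx) (negbTE cy) /= ltnS.
by move=> xs ys; apply: IH.
Qed.

End Words.

(** * Pairwise orders and agility *)

Section PairwiseOrders.

Variables (T : eqType) (ahead : seq T -> rel T).
Implicit Types (x y z : T) (s t w : seq T).

(** Separates the combinatorics from [list_state]: an algorithm is seen only through the order of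
    each pair of items. The last clause is projectivity, stated for two words with equal
    projections. *)
Definition projective_orders :=
  [/\ forall s x y, x != y -> ahead s y x = ~~ ahead s x y,
      forall s x y z, ahead s x y -> ahead s y z -> ahead s x z
    & forall s t x y, x != y -> filter (pred2 x y) s = filter (pred2 x y) t ->
        ahead s x y = ahead t x y].

Hypothesis ahead_orders : projective_orders.

Lemma aheadC s x y : x != y -> ahead s y x = ~~ ahead s x y.
Proof. by case: ahead_orders => + _ _; apply. Qed.

Lemma ahead_trans s x y z : ahead s x y -> ahead s y z -> ahead s x z.
Proof. by case: ahead_orders => _ + _; apply. Qed.

Lemma ahead_proj s t x y : x != y ->
  filter (pred2 x y) s = filter (pred2 x y) t -> ahead s x y = ahead t x y.
Proof. by case: ahead_orders => _ _; apply. Qed.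

(** Agility in terms of [ahead]. The two words may contain other items, which by projectivity do not
    affect the order of x and y. *)
Definition varies x i y j := exists s t,
  [/\ count_mem x s = i, count_mem y s = j, count_mem x t = i, count_mem y t = j
    & ahead s x y && ~~ ahead t x y].

Lemma varies_sym x i y j : x != y -> varies x i y j -> varies y j x i.
Proof.
move=> xy [s [t [? ? ? ? /andP[os ot]]]]; exists t, s.
by rewrite !(aheadC _ xy) os ot.
Qed.

(* The requests to y and to z can be placed relative to x independently: choose
   them so that y is ahead of x and x ahead of z, or the reverse. *)
Lemma varies_trans x i y j z k : x != y -> x != z -> y != z ->
  varies x i y j -> varies x i z k -> varies y j z k.
Proof.
move=> xy xz yz [s [t [xs ys xt yt /andP[os ot]]]].
move=> [s' [t' [xs' zs xt' zt /andP[os' ot']]]].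
have mix u v : count_mem x u = i -> count_mem x v = i ->
    count_mem y u = j -> count_mem z v = k ->
    exists w, [/\ count_mem y w = j, count_mem z w = k,
      ahead w x y = ahead u x y & ahead w x z = ahead v x z].
  move=> xu xv yu zv.
  have [|w [wu wv]] := @interleave _ x y z u v xy xz yz; first by rewrite xu.
  exists w; split; try exact: ahead_proj.
  - by rewrite -(count_filter_pred2r x) wu count_filter_pred2r.
  - by rewrite -(count_filter_pred2r x) wv count_filter_pred2r.
have [w1 [y1 z1 a1 b1]] := mix t s' xt xs' yt zs.
have [w2 [y2 z2 a2 b2]] := mix s t' xs xt' ys zt.
exists w1, w2; split=> //; apply/andP; split.
  by apply: (@ahead_trans _ _ x); rewrite ?(aheadC _ xy) ?a1 ?b1.
rewrite -aheadC //.
by apply: (@ahead_trans _ _ x); rewrite ?(aheadC _ xz) ?a2 ?b2.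
Qed.

(** * Swaps that change an order, seen from a third item *)

(** Relative to z, the request to x with p earlier and p' later ones acts like the request to y with
    r earlier and r' later ones: one function of the numbers of z's on each side gives both
    orders. *)
Definition linked x p p' y r r' z := forall a1 a2 b1 b2,
  count_mem x a1 = p -> count_mem x a2 = p' ->
  count_mem y b1 = r -> count_mem y b2 = r' ->
  count_mem z a1 = count_mem z b1 -> count_mem z a2 = count_mem z b2 ->
  ahead (a1 ++ x :: a2) x z = ahead (b1 ++ y :: b2) y z.

Lemma linked_sym x p p' y r r' z :
  linked x p p' y r r' z -> linked y r r' x p p' z.
Proof. by move=> l a1 a2 b1 b2 *; symmetry; apply: l. Qed.

(** The swap leaves the projections to x, z and to y, z unchanged. If z stood between x and y,
    transitivity would force the same order of x and y before and after the swap. *)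
Lemma swap_ahead x y z a b w v : x != y -> x != z -> y != z ->
  ahead (a ++ x :: y :: b) x y != ahead (a ++ y :: x :: b) x y ->
  filter (pred2 x y) w = filter (pred2 x y) a ->
  filter (pred2 x y) v = filter (pred2 x y) b ->
  ahead (w ++ x :: y :: v) x z = ahead (w ++ x :: y :: v) y z.
Proof.
move=> xy xz yz ne wa vb.
have yx : y == x = false by rewrite eq_sym (negbTE xy).
set s := w ++ x :: y :: v; set t := w ++ y :: x :: v.
have es : ahead (a ++ x :: y :: b) x y = ahead s x y.
  by apply: ahead_proj => //; rewrite !filter_cat /= !eqxx yx wa vb.
have et : ahead (a ++ y :: x :: b) x y = ahead t x y.
  by apply: ahead_proj => //; rewrite !filter_cat /= !eqxx yx wa vb.
have exz : ahead s x z = ahead t x z.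
  by apply: ahead_proj => //; rewrite !filter_cat /= eqxx yx (negbTE yz).
have eyz : ahead s y z = ahead t y z.
  by apply: ahead_proj => //; rewrite !filter_cat /= eqxx (negbTE xy) (negbTE xz).
move: ne; rewrite es et.
have trans u : (ahead u x z && ahead u z y ==> ahead u x y) &&
    (ahead u y z && ahead u z x ==> ahead u y x).
  by apply/andP; split; apply/implyP => /andP[]; apply: ahead_trans.
have := trans s; have := trans t.
rewrite !(aheadC _ xy) !(aheadC _ xz) !(aheadC _ yz) -exz -eyz.
by case: (ahead s x y); case: (ahead t x y); case: (ahead s x z); case: (ahead s y z).
Qed.

(** For c other than x, the projection to x and z does not change. For c equal to x, the projection
    to y and z does not, and the two hypotheses transfer this to x. *)
Lemma ahead_step x y z s c t : x != y -> x != z -> y != z -> c != z ->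
  ahead (s ++ c :: z :: t) x z = ahead (s ++ c :: z :: t) y z ->
  ahead (s ++ z :: c :: t) x z = ahead (s ++ z :: c :: t) y z ->
  ahead (s ++ c :: z :: t) x z = ahead (s ++ z :: c :: t) x z.
Proof.
move=> xy xz yz cz; case: (eqVneq c x) => [-> -> ->|cx _ _].
  by apply: ahead_proj => //; rewrite !filter_cat /= eqxx (negbTE xy) (negbTE xz).
by apply: ahead_proj => //; rewrite !filter_cat /= eqxx (negbTE cx) (negbTE cz).
Qed.

(** Brings the word to a normal form in which [a1] and [a2] enter only through their numbers of
    z's. *)
Lemma swap_canonical x y z a b a1 a2 : x != y -> x != z -> y != z ->
  ahead (a ++ x :: y :: b) x y != ahead (a ++ y :: x :: b) x y ->
  count_mem x a1 = count_mem x a -> count_mem x a2 = count_mem x b ->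
  ahead (a1 ++ x :: a2) x z =
  ahead ((nseq (count_mem z a1) z ++ filter (pred2 x y) a) ++
         x :: y :: nseq (count_mem z a2) z ++ filter (pred2 x y) b) x z.
Proof.
move=> xy xz yz ne c1 c2.
(* On each side, combine the x, y order of the swap with the given placement of the z's. *)
have [w [wa wa1]] := interleave xy xz yz (esym c1).
have [v [vb va2]] := interleave xy xz yz (esym c2).
have wE : filter (pred2 x y) (filter (predC1 z) w) = filter (pred2 x y) a.
  by rewrite filter_pred2_drop.
have vE : filter (pred2 x y) (filter (predC1 z) v) = filter (pred2 x y) b.
  by rewrite filter_pred2_drop.
transitivity (ahead (w ++ x :: y :: v) x z).
  by apply: ahead_proj => //; rewrite !filter_cat /= eqxx wa1 va2
    [y == x]eq_sym (negbTE xy) (negbTE yz).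
(* Sort the z's to the front on the left of the swapped pair, later on its right; no z crosses the
   pair, so [swap_ahead] applies at every step. *)
rewrite (@bubble _ z (fun w => ahead (w ++ x :: y :: v) x z)); last first.
  move=> w1 c w2 cz _ e; rewrite -!catA /=.
  apply: (@ahead_step _ y) => //; rewrite -?cat_cons catA; apply: (@swap_ahead _ _ _ a b) => //.
    by rewrite -(filter_pred2_drop _ xz yz) filter_predC1_swap e.
  by rewrite -(filter_pred2_drop _ xz yz) e.
set w' := nseq _ z ++ filter (predC1 z) w.
have w'E : filter (pred2 x y) w' = filter (pred2 x y) a.
  rewrite /w' filter_cat wE filter_nseq /= [z == x]eq_sym [z == y]eq_sym.
  by rewrite (negbTE xz) (negbTE yz).
rewrite (@bubble _ z (fun v => ahead (w' ++ x :: y :: v) x z)); last first.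
  move=> w1 c w2 cz _ e; rewrite -!cat_cons !catA.
  apply: (@ahead_step _ y) => //; rewrite -catA; apply: (@swap_ahead _ _ _ a b) => //.
    by rewrite -(filter_pred2_drop _ xz yz) filter_predC1_swap e.
  by rewrite -(filter_pred2_drop _ xz yz) e.
have cz s t : filter (pred2 x z) s = filter (pred2 x z) t -> count_mem z s = count_mem z t.
  by move=> e; rewrite -(count_filter_pred2r x) e count_filter_pred2r.
have cx s t : filter (pred2 x y) s = filter (pred2 x y) t -> count_mem x s = count_mem x t.
  by move=> e; rewrite -(count_filter_pred2 x y) e count_filter_pred2.
rewrite /w' (cz _ _ wa1) (cz _ _ va2); apply: ahead_proj => //.
rewrite !filter_cat /= !filter_cat !filter_pred2_predC1 // !filter_pred2_pred2 //.
by rewrite (cx _ _ wa) (cx _ _ vb).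
Qed.

(* While z never comes between the swapped x and y, its order relative to one
   agrees with that relative to the other; since moving z past x leaves the
   projection to y and z unchanged and conversely, only the numbers of z before
   and after the swapped pair matter. *)
Lemma swap_linked x y z a b : x != y -> x != z -> y != z ->
  ahead (a ++ x :: y :: b) x y != ahead (a ++ y :: x :: b) x y ->
  linked x (count_mem x a) (count_mem x b) y (count_mem y a) (count_mem y b) z.
Proof.
move=> xy xz yz ne a1 a2 b1 b2 xa1 xa2 yb1 yb2 z1 z2.
have yx : y != x by rewrite eq_sym.
have ne' : ahead (a ++ y :: x :: b) y x != ahead (a ++ x :: y :: b) y x.
  by rewrite !(aheadC _ xy) (inj_eq negb_inj) eq_sym.
rewrite (swap_canonical xy xz yz ne) // (swap_canonical yx yz xz ne') // -z1 -z2.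
rewrite ![filter (pred2 y x) _]filter_pred2C.
rewrite (swap_ahead xy xz yz ne).
- by apply: ahead_proj => //; rewrite !filter_cat /= eqxx (negbTE xy) (negbTE xz).
- rewrite filter_cat filter_id filter_nseq /= ![z == _]eq_sym.
  by rewrite (negbTE xz) (negbTE yz).
- rewrite filter_cat filter_id filter_nseq /= ![z == _]eq_sym.
  by rewrite (negbTE xz) (negbTE yz).
Qed.

(** If no adjacent swap of x and y mattered, sorting the y's to the front would make the order a
    function of i and j alone. *)
Lemma varies_swap x i y j : x != y -> varies x i y j ->
  exists a b, [/\ (count_mem x a + count_mem x b).+1 = i,
    (count_mem y a + count_mem y b).+1 = j
    & ahead (a ++ x :: y :: b) x y != ahead (a ++ y :: x :: b) x y].
Proof.
move=> xy [s [t [xs ys xt yt /andP[os ot]]]]; apply: NNPP => no.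
have yx : y == x = false by rewrite eq_sym (negbTE xy).
suff canonical u : count_mem x u = i -> count_mem y u = j ->
    ahead u x y = ahead (nseq j y ++ nseq i x) x y.
  by move: ot; rewrite canonical // -(canonical s) // os.
move=> xu yu; rewrite (@bubble _ y (fun w => ahead w x y)).
  rewrite yu; apply: ahead_proj => //.
  by rewrite !filter_cat filter_pred2_predC1 // filter_pred2_nseq xu.
move=> w1 c w2 cy yw fw.
have [ecx|cx] := eqVneq c x; last first.
  by apply: ahead_proj => //; rewrite !filter_cat /= (negbTE cx) (negbTE cy).
subst c.
have [//|ne] := eqVneq (ahead (w1 ++ x :: y :: w2) x y) (ahead (w1 ++ y :: x :: w2) x y).
case: no; exists w1, w2; split=> //.
  have := congr1 (count_mem x) (congr1 (filter (pred2 x y)) fw).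
  rewrite !filter_pred2_predC1 // !count_nseq /= eqxx xu !count_cat /= eqxx yx.
  by lia.
by move: yw; rewrite yu !count_cat /= eqxx (negbTE xy); lia.
Qed.

(** Both words are compared with one word around y having the same numbers of z's on each side. *)
Lemma linked_const x p p' y r r' z : y != z -> linked x p p' y r r' z ->
  forall a1 a2 b1 b2, count_mem x a1 = p -> count_mem x a2 = p' ->
  count_mem x b1 = p -> count_mem x b2 = p' ->
  count_mem z a1 = count_mem z b1 -> count_mem z a2 = count_mem z b2 ->
  ahead (a1 ++ x :: a2) x z = ahead (b1 ++ x :: b2) x z.
Proof.
move=> yz lk a1 a2 b1 b2 xa1 xa2 xb1 xb2 z1 z2.
have zy : z == y = false by rewrite eq_sym (negbTE yz).
pose c1 := nseq (count_mem z b1) z ++ nseq r y.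
pose c2 := nseq (count_mem z b2) z ++ nseq r' y.
have yc1 : count_mem y c1 = r by rewrite count_cat !count_nseq /= eqxx zy mul1n.
have yc2 : count_mem y c2 = r' by rewrite count_cat !count_nseq /= eqxx zy mul1n.
have zc1 : count_mem z c1 = count_mem z b1.
  by rewrite count_cat !count_nseq /= eqxx (negbTE yz) mul1n addn0.
have zc2 : count_mem z c2 = count_mem z b2.
  by rewrite count_cat !count_nseq /= eqxx (negbTE yz) mul1n addn0.
by rewrite (lk _ _ c1 c2) ?zc1 ?zc2 // -(lk b1 b2) ?zc1 ?zc2.
Qed.

(** Finds the critical request to z: moving z's one by one across the critical request to x must
    change the order somewhere, and the change happens at the same place for y. *)
Lemma linked_varies x p p' y r r' z k : x != y -> x != z -> y != z ->
  linked x p p' y r r' z -> varies x (p + p').+1 z k ->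
  exists m m', [/\ (m + m').+1 = k, linked x p p' z m m' y
    & linked y r r' z m m' x].
Proof.
move=> xy xz yz lk [s [t [xs zs xt zt /andP[os ot]]]].
have zx : z == x = false by rewrite eq_sym (negbTE xz).
have zy : z == y = false by rewrite eq_sym (negbTE yz).
have constx := linked_const yz lk; have consty := linked_const xz (linked_sym lk).
pose f u p m := nseq m z ++ nseq p u : seq T.
have fx q m : count_mem x (f x q m) = q.
  by rewrite count_cat !count_nseq /= eqxx zx mul1n.
have fxz q m : count_mem z (f x q m) = m.
  by rewrite count_cat !count_nseq /= eqxx (negbTE xz) mul1n addn0.
have fy q m : count_mem y (f y q m) = q.
  by rewrite count_cat !count_nseq /= eqxx zy mul1n.
have fyz q m : count_mem z (f y q m) = m.
  by rewrite count_cat !count_nseq /= eqxx (negbTE yz) mul1n addn0.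
(* Only the letter counts of [f] matter from here on. [h m] is the order of x and z when m of the k
   requests to z precede the critical request to x. *)
clearbody f; pose h m := ahead (f x p m ++ x :: f x p' (k - m)) x z.
have hE u : count_mem x u = (p + p').+1 -> count_mem z u = k ->
    exists2 m, m <= k & ahead u x z = h m.
  move=> xu zu; have [|u1 [u2 [eu u1p]]] := @split_count _ x p u.
    by rewrite xu; lia.
  subst u; move: xu zu; rewrite !count_cat /= eqxx (negbTE xz) /= => xu zu.
  exists (count_mem z u1); first by lia.
  by apply: constx; rewrite ?fx ?fxz //; lia.
(* If [h] had no jump, it would be constant, contrary to [varies]. *)
have [m ltm hm] : exists2 m, m < k & h m != h m.+1.
  apply: NNPP => no; have h0 n : n <= k -> h n = h 0.
    elim: n => // n IH ltn; rewrite -IH 1?ltnW //.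
    have [//|ne] := eqVneq (h n) (h n.+1); case: no; by exists n.
  have [m1 /h0 e1 hs] := hE s xs zs; have [m2 /h0 e2 ht] := hE t xt zt.
  by move: ot; rewrite ht e2 -e1 -hs os.
exists m, (k - m).-1; split; first by lia.
  have := @swap_linked x z y (f x p m) (f x p' (k - m).-1).
  rewrite !fx !fxz; apply; rewrite ?zy //.
  move: hm; congr (~~ (_ == _)).
    by apply: constx; rewrite /= ?fx ?fxz ?(negbTE xz) ?zx ?eqxx //=; lia.
  rewrite -cat_rcons; apply: constx;
    by rewrite -?cats1 ?count_cat /= ?fx ?fxz ?(negbTE xz) ?zx ?eqxx //=; lia.
(* The link carries the jump of [h] at m over to y. *)
have := @swap_linked y z x (f y r m) (f y r' (k - m).-1).
rewrite !fy !fyz; apply; rewrite ?zx ?(eq_sym y x) //.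
move: hm; congr (~~ (_ == _)).
  by apply: lk; rewrite /= ?fx ?fxz ?fy ?fyz ?(negbTE yz) ?zy ?eqxx //=; lia.
rewrite -cat_rcons; apply: lk;
  by rewrite -?cats1 ?count_cat /= ?fx ?fxz ?fy ?fyz ?(negbTE yz) ?zy ?eqxx //=; lia.
Qed.

(** * Critical requests and their uniqueness *)

(* [c] is true when the item requested first at its critical request comes out
   in front; [p] and [r] count the requests preceding the critical ones. *)
Definition critical c x i p y j r := [/\ p < i, r < j
  & forall s, count_mem x s = i -> count_mem y s = j ->
    (precedes s x p y r -> ahead s x y = c) /\
    (precedes s y r x p -> ahead s x y = ~~ c)].

Lemma critical_sym c x i p y j r : x != y ->
  critical c x i p y j r -> critical c y j r x i p.
Proof.
move=> xy [ltp ltr cr]; split=> // s ys xs; have [c1 c2] := cr s xs ys.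
by split=> [/c2|/c1] e; rewrite (aheadC _ xy) e ?negbK.
Qed.

(** Rearranging around the critical request to x, then around the one to y, turns every word with
    the former first into the same block word. *)
Lemma threshold_half x p p' y r r' s : x != y ->
  (forall a1 a2 b1 b2, count_mem x a1 = p -> count_mem x a2 = p' ->
    count_mem x b1 = p -> count_mem x b2 = p' ->
    count_mem y a1 = count_mem y b1 -> count_mem y a2 = count_mem y b2 ->
    ahead (a1 ++ x :: a2) x y = ahead (b1 ++ x :: b2) x y) ->
  (forall a1 a2 b1 b2, count_mem y a1 = r -> count_mem y a2 = r' ->
    count_mem y b1 = r -> count_mem y b2 = r' ->
    count_mem x a1 = count_mem x b1 -> count_mem x a2 = count_mem x b2 ->
    ahead (a1 ++ y :: a2) y x = ahead (b1 ++ y :: b2) y x) ->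
  count_mem x s = (p + p').+1 -> count_mem y s = (r + r').+1 ->
  precedes s x p y r ->
  ahead s x y = ahead (nseq (p + p').+1 x ++ nseq (r + r').+1 y) x y.
Proof.
move=> xy cx cy xs ys [s1 [s2 [s3 [es xs1 ys2]]]]; subst s.
have yx : y == x = false by rewrite eq_sym (negbTE xy).
pose countE := (@count_memE, negbTE xy, yx).
move: xs ys ys2; rewrite !countE => xs ys ys2.
(* [u] has the y-counts of [s] around the critical x; around the critical y it has all x's in front,
   like the block word. *)
pose u := (nseq (count_mem y s1) y ++ nseq p x) ++
  x :: nseq p' x ++ nseq (count_mem y s2) y ++ y :: nseq r' y.
transitivity (ahead u x y).
  by apply: cx; rewrite ?countE; lia.
apply: negb_inj; rewrite -!(aheadC _ xy).
have -> : u = ((nseq (count_mem y s1) y ++ nseq p x) ++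
  x :: nseq p' x ++ nseq (count_mem y s2) y) ++ y :: nseq r' y.
  by rewrite /u -!catA /= -!catA.
have -> : (r + r').+1 = r + r'.+1 by lia.
rewrite nseqD catA.
by apply: cy; rewrite ?countE; lia.
Qed.

(** By [threshold_half] in both directions, the order is constant on each of the two cases; [varies]
    makes the two constants opposite. *)
Lemma linked_critical x p p' y r r' z m m' :
  x != y -> x != z -> y != z ->
  linked x p p' z m m' y -> linked y r r' z m m' x ->
  varies x (p + p').+1 y (r + r').+1 ->
  critical (ahead (nseq (p + p').+1 x ++ nseq (r + r').+1 y) x y)
    x (p + p').+1 p y (r + r').+1 r.
Proof.
move=> xy xz yz lx ly [s [t [xs ys xt yt /andP[os ot]]]].
have yx : y != x by rewrite eq_sym.
have [zx zy] : z != x /\ z != y by rewrite ![z == _]eq_sym.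
have cx := linked_const zy lx; have cy := linked_const zx ly.
have first u := @threshold_half x p p' y r r' u xy cx cy.
have last u := @threshold_half y r r' x p p' u yx cy cx.
split; try lia; move=> u xu yu; split; first exact: first.
move=> /(last u yu xu); rewrite (aheadC u xy) => e; apply: negb_inj; rewrite e negbK.
have tot w : count_mem x w = (p + p').+1 -> count_mem y w = (r + r').+1 ->
    precedes w x p y r \/ precedes w y r x p.
  by move=> xw yw; apply: precedes_total; rewrite ?xw ?yw //; lia.
case: (tot s xs ys) => [/(first s xs ys)|/(last s ys xs)];
case: (tot t xt yt) => [/(first t xt yt)|/(last t yt xt)];
rewrite ?(aheadC _ xy) ?os ?(negbTE ot);
  by case: (ahead (nseq _ x ++ _) x y); case: (ahead (nseq _ y ++ _) x y).
Qed.

Lemma critical_block c x i p y j r : x != y -> critical c x i p y j r ->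
  ahead (nseq i x ++ nseq j y) x y = c.
Proof.
move=> xy [ltp ltr cr].
have yx : y == x = false by rewrite eq_sym (negbTE xy).
apply: (proj1 (cr _ _ _)).
- by rewrite count_cat !count_nseq /= eqxx yx; lia.
- by rewrite count_cat !count_nseq /= eqxx (negbTE xy); lia.
exists (nseq p x), (nseq (i - p).-1 x ++ nseq r y), (nseq (j - r).-1 y); split.
- by rewrite (nseq_split x ltp) (nseq_split y ltr) -!catA.
- by rewrite count_nseq /= eqxx mul1n.
- by rewrite count_cat /= count_cat !count_nseq /= (negbTE xy) eqxx; lia.
Qed.

(** The word of all x's followed by all y's determines the direction. *)
Lemma critical_unique c c' x i p p' y j r r' : x != y ->
  critical c x i p y j r -> critical c' x i p' y j r' -> c = c' /\ p = p'.
Proof.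
move=> xy cr cr'; have ec := critical_block xy cr.
rewrite (critical_block xy cr') in ec; split=> //; subst c'.
suff no a b u v : a < b -> critical c x i a y j u -> critical c x i b y j v -> False.
  by case: (ltngtP p p') => // lt; [case: (no _ _ _ _ lt cr cr') | case: (no _ _ _ _ lt cr' cr)].
move=> ltab [_ ltu cra] [ltb ltv crb].
have yx : y == x = false by rewrite eq_sym (negbTE xy).
(* The block of y's separates the candidates: the x with a predecessors comes before it, the x with
   b predecessors after it, so the two rules contradict each other. *)
pose s := nseq b x ++ nseq j y ++ nseq (i - b) x.
have xs : count_mem x s = i.
  by rewrite !count_cat !count_nseq /= eqxx yx; lia.
have ys : count_mem y s = j.
  by rewrite !count_cat !count_nseq /= eqxx (negbTE xy); lia.
have /(proj1 (cra s xs ys)) eqc : precedes s x a y u.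
  exists (nseq a x), (nseq (b - a).-1 x ++ nseq u y),
    (nseq (j - u).-1 y ++ nseq (i - b) x); split.
  - by rewrite /s (nseq_split x ltab) (nseq_split y ltu) -!catA.
  - by rewrite count_nseq /= eqxx mul1n.
  - by rewrite count_cat /= count_cat !count_nseq /= (negbTE xy) eqxx; lia.
suff /(proj2 (crb s xs ys)) : precedes s y v x b by rewrite eqc; case: (c).
exists (nseq b x ++ nseq v y), (nseq (j - v).-1 y), (nseq (i - b).-1 x); split.
- rewrite /s (nseq_split y ltv) -!catA /=; congr (_ ++ _ ++ _ :: _ ++ _).
  by rewrite (_ : i - b = (i - b).-1.+1) //; lia.
- by rewrite count_cat !count_nseq /= (negbTE xy) eqxx; lia.
- by rewrite !count_cat /= !count_nseq /= yx eqxx; lia.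
Qed.

(** One swap of x and y yields links between all three items, hence a critical request for each item
    that serves both of its pairs. *)
Lemma critical_triple x i y j z k : x != y -> x != z -> y != z ->
  varies x i y j -> varies x i z k ->
  exists c p r m, critical c x i p y j r /\ critical c x i p z k m.
Proof.
move=> xy xz yz vxy vxz.
have [yx zx zy] : [/\ y != x, z != x & z != y] by rewrite !(eq_sym z) eq_sym.
have vzy : varies z k y j.
  by apply: varies_sym => //; apply: varies_trans vxy vxz.
have [a [b [ei ej ne]]] := varies_swap xy vxy.
have := swap_linked xy xz yz ne; move: ei ej => + + lz.
move: (count_mem x a) (count_mem x b) (count_mem y a) (count_mem y b) lz.
move=> p p' r r' lz ei ej; subst i j.
have [m [m' [ek ly lx]]] := linked_varies xy xz yz lz vxz; subst k.
have cxy := linked_critical xy xz yz ly lx vxy.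
have cxz := linked_critical xz xy zy lz (linked_sym lx) vxz.
have czy := linked_critical zy zx yx (linked_sym ly) (linked_sym lz) vzy.
have nseqSD u q q' : nseq (q + q').+1 u = nseq q u ++ u :: nseq q' u :> seq T.
  by rewrite (@nseq_split _ _ q); [congr (_ ++ _ :: nseq _ _); lia | lia].
(* Exchanging linked items in front of a block shows that x, y has the direction of z, y, and x, z
   that of y, z. *)
have exy : ahead (nseq (p + p').+1 x ++ nseq (r + r').+1 y) x y =
           ahead (nseq (m + m').+1 z ++ nseq (r + r').+1 y) z y.
  rewrite !(nseqSD x) !(nseqSD z) -!catA /=.
  by apply: ly; rewrite ?(count_memE, negbTE yx, negbTE yz); lia.
have exz : ahead (nseq (p + p').+1 x ++ nseq (m + m').+1 z) x z =
           ahead (nseq (r + r').+1 y ++ nseq (m + m').+1 z) y z.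
  rewrite !(nseqSD x) !(nseqSD y) -!catA /=.
  by apply: lz; rewrite ?(count_memE, negbTE zx, negbTE zy); lia.
exists (ahead (nseq (p + p').+1 x ++ nseq (r + r').+1 y) x y), p, r, m; split=> //.
by rewrite exy -(critical_block yz (critical_sym zy czy)) -exz.
Qed.

(** Any partner u forms a triple with x and one of y, z; uniqueness on the known pair fixes the
    index and the direction. *)
Lemma critical_uniform x i y j z k : x != y -> x != z -> y != z ->
  varies x i y j -> varies x i z k ->
  exists c p, p < i /\ forall u l, x != u -> varies x i u l ->
    exists r, critical c x i p u l r.
Proof.
move=> xy xz yz vxy vxz.
have [c [p [r [m [cy cz]]]]] := critical_triple xy xz yz vxy vxz.
exists c, p; split=> [|u l xu vxu]; first by case: cy.
case: (eqVneq u y) => [eu|]; last rewrite eq_sym => yu.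
  have zy : z != u by rewrite eu eq_sym.
  subst u; have [c' [p' [m' [r' [cz' cu]]]]] := critical_triple xz xu zy vxz vxu.
  by have [-> ->] := critical_unique xz cz cz'; exists r'.
have [c' [p' [r' [q [cy' cu]]]]] := critical_triple xy xu yu vxy vxu.
by have [-> ->] := critical_unique xy cy cy'; exists q.
Qed.

End PairwiseOrders.

(** * List states as pairwise orders *)

Section Projective.

Variables (L : finType) (S : seq L -> list_state L).
Hypothesis HS : projective S.
Implicit Types (x y z : L) (s t w : seq L).

Definition ahead s x y := index x (S s) < index y (S s).

Lemma mem_state s x : x \in (S s : seq L).
Proof. by rewrite (perm_mem (state_seqP (S s))) mem_enum. Qed.

Lemma pair_projE s x y : x != y ->
  pair_proj x y (S s) = if ahead s x y then [:: x; y] else [:: y; x].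
Proof.
apply: filter_pred2_uniq; rewrite ?mem_state //.
by rewrite (perm_uniq (state_seqP (S s))) enum_uniq.
Qed.

Lemma state_aheadC s x y : x != y -> ahead s y x = ~~ ahead s x y.
Proof.
move=> xy; rewrite /ahead -leqNgt ltn_neqAle.
case: eqP => // /(congr1 (fun n => nth x (S s) n)).
by rewrite !nth_index ?mem_state // => /eqP; rewrite eq_sym (negbTE xy).
Qed.

Lemma state_ahead_proj s t x y : x != y ->
  filter (pred2 x y) s = filter (pred2 x y) t -> ahead s x y = ahead t x y.
Proof.
move=> xy st.
have : pair_proj x y (S s) = pair_proj x y (S t).
  by rewrite (HS x y s) (HS x y t) [pair_proj x y s]st.
rewrite !pair_projE //; do 2!case: ahead => //; case=> e; by move: xy; rewrite e eqxx.
Qed.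

Lemma ahead_projective : projective_orders ahead.
Proof.
split; [exact: state_aheadC | | exact: state_ahead_proj].
by move=> s x y z; apply: ltn_trans.
Qed.

Lemma agile_varies x i y j : agile S (x, i) (y, j) -> varies ahead x i y j.
Proof.
move=> [/= /eqP xy [s es os] [t et ot]]; exists s, t.
have cnt u : perm_eq u (word (x, i) ++ word (y, j)) ->
    count_mem x u = i /\ count_mem y u = j.
  move=> /permP e; rewrite !e !count_cat !count_nseq /= !eqxx.
  by rewrite (negbTE xy) eq_sym (negbTE xy) !mul1n addn0.
have [-> ->] := cnt _ es; have [-> ->] := cnt _ et; split=> //.
apply/andP; split.
  by move: os; rewrite pair_projE //; case: ahead => //; case=> e; rewrite e eqxx in xy.
by move: ot; rewrite pair_projE //; case: ahead => //; case=> e; rewrite e eqxx in xy.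
Qed.

End Projective.

(** * The choice of critical requests and the two cases *)

Lemma requested_precedes (L : finType) (s : seq L) x q y l :
  requested_before s x q y l -> precedes s x q.-1 y l.-1.
Proof.
have take_request u n m : is_request s u n m -> count_mem u (take m s) = n.-1.
  move=> [lt em <-].
  by rewrite (take_nth u) // em -cats1 count_cat /= eqxx addn1.
move=> [a [b [ra rb ltab]]]; have [lta ea _] := ra; have [ltb eb _] := rb.
set t := take b s.
have et : t = take a s ++ x :: drop a.+1 t.
  rewrite -{1}(cat_take_drop a t) /t take_takel 1?ltnW //.
  by rewrite (drop_nth x) ?nth_take ?ea // size_takel // ltnW.
exists (take a s), (drop a.+1 t), (drop b.+1 s); split; last 2 first.
- exact: take_request ra.
- by rewrite -et; exact: take_request rb.
rewrite -cat_cons catA -et -{1}(cat_take_drop b s) (drop_nth y) //.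
by rewrite eb.
Qed.

Theorem theorem11 (L : finType) (S : seq L -> list_state L) (HS : projective S) :
  exists F : unary L -> nat,
    (forall (x : L) (i : nat), F (x, i) <= i) /\
    forall Q : unary L -> Prop,
      (exists x y z : L, exists i j k : nat,
          [/\ x <> y, x <> z & y <> z] /\ [/\ Q (x, i), Q (y, j) & Q (z, k)]) ->
      (forall (x y : L) (i j : nat),
          Q (x, i) -> Q (y, j) -> x <> y -> agile S (x, i) (y, j)) ->
      (* the requests x_(F(x^i)) referred to below do exist *)
      (forall (x : L) (i : nat), Q (x, i) -> 1 <= F (x, i)) /\
      ((forall (x y : L) (i j : nat), Q (x, i) -> Q (y, j) -> x <> y ->
          let q := F (x, i) in
          let l := F (y, j) in
          forall sigma : seq L,
            item_proj x sigma = word (x, i) -> item_proj y sigma = word (y, j) ->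
            (requested_before sigma y l x q -> pair_proj x y (S sigma) = [:: x; y]) /\
            (requested_before sigma x q y l -> pair_proj x y (S sigma) = [:: y; x]))
       \/
       (forall (x y : L) (i j : nat), Q (x, i) -> Q (y, j) -> x <> y ->
          let q := F (x, i) in
          let l := F (y, j) in
          forall sigma : seq L,
            item_proj x sigma = word (x, i) -> item_proj y sigma = word (y, j) ->
            (requested_before sigma x q y l -> pair_proj x y (S sigma) = [:: x; y]) /\
            (requested_before sigma y l x q -> pair_proj x y (S sigma) = [:: y; x]))).
Proof.
pose o := ahead S; have ho : projective_orders o := ahead_projective HS.
pose chosen x i c q := 0 < q /\ forall y j, x != y -> varies o x i y j ->
  exists r, critical o c x i q.-1 y j r.
have exF (u : unary L) : exists q, q <= u.2 /\ forall y j z k,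
    u.1 != y -> u.1 != z -> y != z -> varies o u.1 u.2 y j ->
    varies o u.1 u.2 z k -> exists c, chosen u.1 u.2 c q.
  case: u => x i /=.
  have [[y [j [z [k [xy [xz [yz [vy vz]]]]]]]]|no] := classic (exists y j z k,
    x != y /\ x != z /\ y != z /\ varies o x i y j /\ varies o x i z k).
    have [c [p [ltp cr]]] := critical_uniform ho xy xz yz vy vz.
    by exists p.+1; split=> // *; exists c.
  (* Default value when there are no two distinct partners; the required property is then
     vacuous. *)
  exists 0; split=> // y j z k xy xz yz vy vz; case: no.
  by exists y, j, z, k.
have [F hF] := functional_choice _ exF.
exists F; split=> [x i|Q three ag]; first by case: (hF (x, i)).
have va x y i j : Q (x, i) -> Q (y, j) -> x != y -> varies o x i y j.
  by move=> qx qy /eqP xy; apply: (agile_varies (ag _ _ _ _ qx qy xy)).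
have two x : exists y j z k, [/\ x != y, x != z, y != z, Q (y, j) & Q (z, k)].
  move: three => [a [b [c [ia [ib [ic [[/eqP ab /eqP ac /eqP bc] [qa qb qc]]]]]]]].
  case: (eqVneq x a) => [->|xa]; first by exists b, ib, c, ic.
  case: (eqVneq x b) => [->|xb]; last by exists a, ia, b, ib.
  by exists a, ia, c, ic; split; rewrite // eq_sym.
have ch x i : Q (x, i) -> exists c, chosen x i c (F (x, i)).
  move=> qx; have [y [j [z [k [xy xz yz qy qz]]]]] := two x.
  by have [_ /= /(_ y j z k)] := hF (x, i); apply=> //; apply: va.
(* Each item supplies its own index, with some index for the partner; uniqueness from both sides
   identifies them. *)
have pair x y i j c d : Q (x, i) -> Q (y, j) -> x != y ->
    chosen x i c (F (x, i)) -> chosen y j d (F (y, j)) ->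
    c = d /\ critical o c x i (F (x, i)).-1 y j (F (y, j)).-1.
  move=> qx qy xy [_ cx] [_ cy]; have yx : y != x by rewrite eq_sym.
  have [r cr] := cx y j xy (va _ _ _ _ qx qy xy).
  have [p /(critical_sym ho yx) cr'] := cy x i yx (va _ _ _ _ qy qx yx).
  have [ec _] := critical_unique xy cr cr'.
  have [_ <-] := critical_unique yx (critical_sym ho xy cr) (critical_sym ho xy cr').
  by [].
split=> [x i /ch [c []] //|].
have [x0 [i0 [c0 [q0 ch0]]]] : exists x i c, Q (x, i) /\ chosen x i c (F (x, i)).
  have [x [_ [_ [i [_ [_ [_ [qx _ _]]]]]]]] := three.
  by have [c chx] := ch _ _ qx; exists x, i, c.
have same x i c : Q (x, i) -> chosen x i c (F (x, i)) -> c = c0.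
  (* Since [pair] compares different items only, a power of the item [x0] itself is reached through
     a second item y. *)
  move=> qx cx; case: (eqVneq x x0) => [ex|xx0]; last first.
    by case: (pair _ _ _ _ _ _ qx q0 xx0 cx ch0).
  have [y [j [_ [_ [xy _ _ qy _]]]]] := two x; have [d cy] := ch _ _ qy.
  have [-> _] := pair _ _ _ _ _ _ qx qy xy cx cy.
  by rewrite eq_sym ex in xy; case: (pair _ _ _ _ _ _ qy q0 xy cy ch0).
have crit x y i j : Q (x, i) -> Q (y, j) -> x != y ->
    critical o c0 x i (F (x, i)).-1 y j (F (y, j)).-1.
  move=> qx qy xy; have [c cx] := ch _ _ qx; have [d cy] := ch _ _ qy.
  by have [_] := pair _ _ _ _ _ _ qx qy xy cx cy; rewrite (same _ _ _ qx cx).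
have cnt x i s : item_proj x s = word (x, i) -> count_mem x s = i.
  by move=> e; rewrite -(size_nseq i x) -[nseq i x]e size_filter.
have main x y i j s : Q (x, i) -> Q (y, j) -> x <> y ->
    item_proj x s = word (x, i) -> item_proj y s = word (y, j) ->
    (requested_before s x (F (x, i)) y (F (y, j)) ->
      pair_proj x y (S s) = if c0 then [:: x; y] else [:: y; x]) /\
    (requested_before s y (F (y, j)) x (F (x, i)) ->
      pair_proj x y (S s) = if c0 then [:: y; x] else [:: x; y]).
  move=> qx qy /eqP xy /cnt xs /cnt ys; have [_ _ /(_ s xs ys) [c1 c2]] := crit _ _ _ _ qx qy xy.
  by split=> /requested_precedes; [move/c1|move/c2]; rewrite pair_projE // -/o => ->; case: (c0).
(* If [c0] is true, the item with the earlier critical request is in front, which is the second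
   alternative. *)
case: (c0) main => main; [right|left] => x y i j qx qy xy q l s xs ys;
  by have [] := main _ _ _ _ _ qx qy xy xs ys.
Qed.
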